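(* Let $C$ and $H$ be commutative Hopf algebras over a field $k$ (with antipodes $S_C$, $S_H$) such that $(C,\rho^l,\rho^r)$ is an $H$-bicomodule Hopf algebra. Let $R:C\to C$ be a linear map and let $B$ be a Rota-Baxter co-operator on $H$. Define $\widetilde{B}:C\ltimes H\to C\ltimes H$ by $$\widetilde{B}(c\ltimes h)=R(c_{(0)[0]})\ltimes B\big(c_{(-1)}c_{(0)[1]}h\big),\qquad c\in C,\ h\in H.$$ Then $\widetilde{B}$ is a Rota-Baxter co-operator on $C\ltimes H$ if and only if $R$ is a Rota-Baxter co-operator on $C$ and, for all $c\in C$, $$R(c)_{1[0]1}\,R\big(R(c)_{1[0]2}\,S_C(R(c)_{3(0)})\big)\otimes R(c)_2\otimes R(c)_{1[1]}R(c)_{3(-1)}=R(c_{1(0)})\otimes R(c_2)\otimes B\big(S_H(c_{1(-1)})\big),$$ $$R(c)_{[0](-1)1}\,B\big(R(c)_{[0](-1)2}\,S_H(R(c)_{[1]})\big)\otimes R(c)_{[0](0)}=B\big(S_H(c_{[1]})\big)\otimes R(c_{[0]}).$$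
   Context: Sweedler notation: $\Delta(c)=c_1\otimes c_2$ (iterated $c_1\otimes c_2\otimes c_3\otimes\cdots$), left coaction $\rho^l(c)=c_{(-1)}\otimes c_{(0)}\in H\otimes C$, right coaction $\rho^r(c)=c_{[0]}\otimes c_{[1]}\in C\otimes H$; subscripts compose left to right, e.g. $R(c)_{1[0]2}$ means: take $R(c)_1$ from $\Delta^{(2)}(R(c))=R(c)_1\otimes R(c)_2\otimes R(c)_3$, apply $\rho^r$ to get $R(c)_{1[0]}\otimes R(c)_{1[1]}$, then apply $\Delta$ to $R(c)_{1[0]}$ to get $R(c)_{1[0]1}\otimes R(c)_{1[0]2}$. A Rota-Baxter co-operator on a commutative Hopf algebra $(H,S)$ is an algebra map $B:H\to H$ with $B(x_1)\otimes B(x_2)=B(x)_1B\big(B(x)_2S(B(x)_4)\big)\otimes B(x)_3$ for all $x$. $C$ is an $H$-bicomodule Hopf algebra if $C$ is an $H$-bicomodule via $\rho^l,\rho^r$ (so $(\mathrm{id}\otimes\rho^r)\rho^l=(\rho^l\otimes\mathrm{id})\rho^r$) such that $\rho^l,\rho^r$ are algebra maps ($(ab)_{(-1)}\otimes(ab)_{(0)}=a_{(-1)}b_{(-1)}\otimes a_{(0)}b_{(0)}$, $(ab)_{[0]}\otimes(ab)_{[1]}=a_{[0]}b_{[0]}\otimes a_{[1]}b_{[1]}$, $\rho^l(1)=1\otimes1$, $\rho^r(1)=1\otimes 1$), $c_{(-1)}\otimes c_{(0)1}\otimes c_{(0)2}=c_{1(-1)}c_{2(-1)}\otimes c_{1(0)}\otimes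 c_{2(0)}$, $c_{[0]1}\otimes c_{[0]2}\otimes c_{[1]}=c_{1[0]}\otimes c_{2[0]}\otimes c_{1[1]}c_{2[1]}$, $\varepsilon(c_{(0)})c_{(-1)}=\varepsilon(c)1_H=\varepsilon(c_{[0]})c_{[1]}$, and $S_C$ is $H$-bicolinear. The L-R smash coproduct $C\ltimes H$ is $C\otimes H$ (elements $c\ltimes h$) with the tensor product algebra structure $(c\ltimes g)(d\ltimes h)=cd\ltimes gh$, unit $1_C\ltimes 1_H$, comultiplication $\Delta(c\ltimes h)=(c_{1[0]}\ltimes c_{2(-1)}h_1)\otimes(c_{2(0)}\ltimes h_2c_{1[1]})$, counit $\varepsilon(c)\varepsilon(h)$, antipode $S(c\ltimes h)=S_C(c_{(0)[0]})\ltimes S_H(c_{(-1)}c_{(0)[1]}h)$; for commutative $H$ this is a Hopf algebra (commutative when $C,H$ are). *)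

(* Defs.v *)
(* Commutative Hopf algebras over a field k, bicomodule Hopf
   algebras, the L-R smash coproduct C ⋉ H and Rota-Baxter co-operators.

   Tensor products are not available in MathComp.  An element of a tensor
   product V1 ⊗ ... ⊗ Vn is represented by a finite formal sum of pure tensors,
   i.e. a list [seq (v1, ..., vn)], and two such lists are declared equal in
   V1 ⊗ ... ⊗ Vn exactly when they have the same image under every
   multilinear map V1 × ... × Vn -> U into every k-vector space U (this is the
   universal property defining the tensor product).  Comultiplications and
   coactions are functions returning such lists (i.e. a choice of Sweedler
   representatives). *)
From HB Require Import structures.
From mathcomp Require Import all_boot all_order all_algebra.
Set Implicit Arguments. Unset Strict Implicit. Unset Printing Implicit Defensive.
Import GRing.Theory.
Local Open Scope ring_scope.

(* monadic bind on lists: sum over Sweedler components *)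
Definition sbind (T U : Type) (s : seq T) (f : T -> seq U) : seq U :=
  flatten (map f s).

Section Tensors.
Variable k : fieldType.

Definition lin (A U : lmodType k) (f : A -> U) : Prop :=
  forall (a : k) (x y : A), f (a *: x + y) = a *: f x + f y.

Definition bilin (A B U : lmodType k) (f : A -> B -> U) : Prop :=
  (forall b, lin (fun a => f a b)) /\ (forall a, lin (f a)).

Definition trilin (A B C U : lmodType k) (f : A -> B -> C -> U) : Prop :=
  [/\ (forall b c, lin (fun a => f a b c)),
      (forall a c, lin (fun b => f a b c)) &
      (forall a b, lin (f a b))].

Definition quadlin (A B C D U : lmodType k) (f : A -> B -> C -> D -> U) : Prop :=
  [/\ (forall b c d, lin (fun a => f a b c d)),
      (forall a c d, lin (fun b => f a b c d)),
      (forall a b d, lin (fun c => f a b c d)) &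
      (forall a b c, lin (f a b c))].

Definition teq2 (A B : lmodType k) (s t : seq (A * B)) : Prop :=
  forall (U : lmodType k) (f : A -> B -> U), bilin f ->
    \sum_(p <- s) f p.1 p.2 = \sum_(p <- t) f p.1 p.2.

Definition teq3 (A B C : lmodType k) (s t : seq (A * B * C)) : Prop :=
  forall (U : lmodType k) (f : A -> B -> C -> U), trilin f ->
    \sum_(p <- s) f p.1.1 p.1.2 p.2 = \sum_(p <- t) f p.1.1 p.1.2 p.2.

Definition teq4 (A B C D : lmodType k) (s t : seq (A * B * C * D)) : Prop :=
  forall (U : lmodType k) (f : A -> B -> C -> D -> U), quadlin f ->
    \sum_(p <- s) f p.1.1.1 p.1.1.2 p.1.2 p.2
    = \sum_(p <- t) f p.1.1.1 p.1.1.2 p.1.2 p.2.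

Record hopf_ops (A : comAlgType k) := HopfOps {
  cop : A -> seq (A * A);
  cou : A -> k;
  antip : A -> A }.

Definition cop2 (A : comAlgType k) (h : hopf_ops A) (x : A) : seq (A * A * A) :=
  sbind (cop h x) (fun p => sbind (cop h p.1) (fun q => [:: (q.1, q.2, p.2)])).

Definition cop3 (A : comAlgType k) (h : hopf_ops A) (x : A) : seq (A * A * A * A) :=
  sbind (cop h x) (fun p => sbind (cop h p.1) (fun q => sbind (cop h q.1)
    (fun r => [:: (r.1, r.2, q.2, p.2)]))).

Definition lin2 (V A B : lmodType k) (f : V -> seq (A * B)) : Prop :=
  forall (a : k) (x y : V),
    teq2 (f (a *: x + y)) ([seq (a *: p.1, p.2) | p <- f x] ++ f y).

Definition hopf_algebra (A : comAlgType k) (h : hopf_ops A) : Prop :=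
  [/\ lin2 (cop h) /\
      (forall x y, teq2 (cop h (x * y))
          (sbind (cop h x) (fun p => sbind (cop h y)
             (fun q => [:: (p.1 * q.1, p.2 * q.2)])))),
      teq2 (cop h 1) [:: (1, 1)] /\
      (forall x, teq3 (sbind (cop h x) (fun p => sbind (cop h p.1)
                          (fun q => [:: (q.1, q.2, p.2)])))
                     (sbind (cop h x) (fun p => sbind (cop h p.2)
                          (fun q => [:: (p.1, q.1, q.2)])))),
      (lin (U := k^o) (cou h) /\ (forall x y, cou h (x * y) = cou h x * cou h y) /\ cou h 1 = 1),
      (forall x, \sum_(p <- cop h x) cou h p.1 *: p.2 = x /\
                 \sum_(p <- cop h x) cou h p.2 *: p.1 = x) &
      lin (antip h) /\
      (forall x, \sum_(p <- cop h x) antip h p.1 * p.2 = cou h x *: 1 /\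
                 \sum_(p <- cop h x) p.1 * antip h p.2 = cou h x *: 1)].

Definition alg_map (A : comAlgType k) (f : A -> A) : Prop :=
  [/\ lin f, (forall x y, f (x * y) = f x * f y) & f 1 = 1].

Definition rota_baxter_coop (A : comAlgType k) (h : hopf_ops A) (B : A -> A) : Prop :=
  alg_map B /\
  forall x, teq2 [seq (B p.1, B p.2) | p <- cop h x]
                 [seq (y.1.1.1 * B (y.1.1.2 * antip h y.2), y.1.2) | y <- cop3 h (B x)].

Section Bicomodule.
Variables (C H : comAlgType k) (hC : hopf_ops C) (hH : hopf_ops H).
Variables (rl : C -> seq (H * C)) (rr : C -> seq (C * H)).

Definition bicomodule_hopf : Prop :=
  [/\
   (lin2 rl /\
   (forall c, teq3 (sbind (rl c) (fun p => sbind (cop hH p.1)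
                      (fun d => [:: (d.1, d.2, p.2)])))
                   (sbind (rl c) (fun p => sbind (rl p.2)
                      (fun q => [:: (p.1, q.1, q.2)])))) /\
   (forall c, \sum_(p <- rl c) cou hH p.1 *: p.2 = c)) /\
   (lin2 rr /\
   (forall c, teq3 (sbind (rr c) (fun p => sbind (rr p.1)
                      (fun q => [:: (q.1, q.2, p.2)])))
                   (sbind (rr c) (fun p => sbind (cop hH p.2)
                      (fun d => [:: (p.1, d.1, d.2)])))) /\
   (forall c, \sum_(p <- rr c) cou hH p.2 *: p.1 = c)),
   (forall c, teq3 (sbind (rl c) (fun p => sbind (rr p.2)
                      (fun q => [:: (p.1, q.1, q.2)])))
                   (sbind (rr c) (fun q => sbind (rl q.1)
                      (fun p => [:: (p.1, p.2, q.2)])))),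
   ((forall a b, teq2 (rl (a * b)) (sbind (rl a) (fun p => sbind (rl b)
                      (fun q => [:: (p.1 * q.1, p.2 * q.2)])))) /\
    teq2 (rl 1) [:: (1, 1)] /\
    (forall a b, teq2 (rr (a * b)) (sbind (rr a) (fun p => sbind (rr b)
                      (fun q => [:: (p.1 * q.1, p.2 * q.2)])))) /\
    teq2 (rr 1) [:: (1, 1)]),
   ((forall c, teq3 (sbind (rl c) (fun p => sbind (cop hC p.2)
                       (fun d => [:: (p.1, d.1, d.2)])))
                    (sbind (cop hC c) (fun d => sbind (rl d.1) (fun q =>
                       sbind (rl d.2) (fun r => [:: (q.1 * r.1, q.2, r.2)]))))) /\
    (forall c, teq3 (sbind (rr c) (fun p => sbind (cop hC p.1)
                       (fun d => [:: (d.1, d.2, p.2)])))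
                    (sbind (cop hC c) (fun d => sbind (rr d.1) (fun q =>
                       sbind (rr d.2) (fun r => [:: (q.1, r.1, q.2 * r.2)])))))) &
   (forall c, \sum_(p <- rl c) cou hC p.2 *: p.1 = cou hC c *: 1 /\
              \sum_(p <- rr c) cou hC p.1 *: p.2 = cou hC c *: 1) /\
   (forall c, teq2 (rl (antip hC c)) [seq (p.1, antip hC p.2) | p <- rl c] /\
              teq2 (rr (antip hC c)) [seq (antip hC p.1, p.2) | p <- rr c])].

(* ---- the L-R smash coproduct C ⋉ H = C ⊗ H ----
   A pure tensor c ⋉ h is the pair (c, h); an element of C ⋉ H is a list of
   pure tensors (their sum); equality in C ⋉ H is teq2, equality in
   (C ⋉ H) ⊗ (C ⋉ H) = C ⊗ H ⊗ C ⊗ H is teq4. *)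

Definition sm_mul (s t : seq (C * H)) : seq (C * H) :=
  sbind s (fun x => sbind t (fun y => [:: (x.1 * y.1, x.2 * y.2)])).

Definition sm_cop (x : C * H) : seq ((C * H) * (C * H)) :=
  sbind (cop hC x.1) (fun p => sbind (rr p.1) (fun a => sbind (rl p.2)
    (fun b => sbind (cop hH x.2) (fun g =>
      [:: ((a.1, b.1 * g.1), (b.2, g.2 * a.2))])))).

Definition sm_cop3 (s : seq (C * H)) :
    seq ((C * H) * (C * H) * (C * H) * (C * H)) :=
  sbind s (fun x => sbind (sm_cop x) (fun p => sbind (sm_cop p.1)
    (fun q => sbind (sm_cop q.1) (fun r => [:: (r.1, r.2, q.2, p.2)])))).

Definition sm_antip (x : C * H) : seq (C * H) :=
  sbind (rl x.1) (fun p => sbind (rr p.2)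
    (fun q => [:: (antip hC q.1, antip hH (p.1 * q.2 * x.2))])).

Definition Btilde (R : C -> C) (B : H -> H) (x : C * H) : seq (C * H) :=
  sbind (rl x.1) (fun p => sbind (rr p.2)
    (fun q => [:: (R q.1, B (p.1 * q.2 * x.2))])).

Definition ext (T : C * H -> seq (C * H)) (s : seq (C * H)) : seq (C * H) :=
  sbind s T.

Definition smash_rota_baxter_coop (T : C * H -> seq (C * H)) : Prop :=
  [/\ (forall s t : seq (C * H),
         teq2 (ext T (sm_mul s t)) (sm_mul (ext T s) (ext T t))),
      teq2 (T (1, 1)) [:: (1, 1)] &
      (forall s : seq (C * H),
        teq4
          (sbind (sbind s sm_cop) (fun uv => sbind (T uv.1) (fun a =>
             sbind (T uv.2) (fun b => [:: (a.1, a.2, b.1, b.2)]))))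
          (sbind (sm_cop3 (ext T s)) (fun y =>
             sbind (ext T (sm_mul [:: y.1.1.2] (sm_antip y.2))) (fun z =>
               [:: (y.1.1.1.1 * z.1, y.1.1.1.2 * z.2, y.1.2.1, y.1.2.2)]))))].

Definition compat1 (R : C -> C) (B : H -> H) (c : C) : Prop :=
  teq3
    (sbind (cop2 hC (R c)) (fun y => sbind (rr y.1.1) (fun a =>
       sbind (cop hC a.1) (fun d => sbind (rl y.2) (fun e =>
         [:: (d.1 * R (d.2 * antip hC e.2), y.1.2, a.2 * e.1)])))))
    (sbind (cop hC c) (fun p => sbind (rl p.1) (fun q =>
       [:: (R q.2, R p.2, B (antip hH q.1))]))).

Definition compat2 (R : C -> C) (B : H -> H) (c : C) : Prop :=
  teq2
    (sbind (rr (R c)) (fun a => sbind (rl a.1) (fun b =>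
       sbind (cop hH b.1) (fun d => [:: (d.1 * B (d.2 * antip hH a.2), b.2)]))))
    (sbind (rr c) (fun a => [:: (B (antip hH a.2), R a.1)])).

End Bicomodule.
End Tensors.

(* Main.v *)
(* Yoneda reduction to groups.  For a commutative algebra K the algebra maps
   N = Alg(C, K) and G = Alg(H, K) are groups under convolution, the coactions
   become commuting left and right actions of G on N by automorphisms, and R, B
   become maps r : N -> N, b : G -> G; the Rota-Baxter identity reads
   f x * f y = f (x * f x * y * (f x)^-1).  Points of the smash coproduct are
   pairs (n, g) with product ((n <| h) * (g |> m), g * h), and Btilde becomes
   (n, g) |-> (b g |> r n <| b g, b g), so the theorem reduces to an equivalence
   in groups.  Identities between tensors are detected on points because the
   tensor product algebra carries a universal point.  R is an algebra map as
   soon as Btilde is, being its image under the counit of H. *)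
Require Import Defs.
From HB Require Import structures.
From mathcomp Require Import all_boot all_order all_algebra.
From mathcomp Require Import boolp ring.
Set Implicit Arguments. Unset Strict Implicit. Unset Printing Implicit Defensive.
Import GRing.Theory.
Local Open Scope ring_scope.
Local Open Scope quotient_scope.

(** * The equivalence for a group with commuting left and right actions on another *)

Section GroupLevel.
Local Open Scope group_scope.
Variables (N G : groupType) (la : G -> N -> N) (ra : N -> G -> N).
Local Notation "g |> n" := (la g n) (at level 38, right associativity).
Local Notation "n <| g" := (ra n g) (at level 39, left associativity).
Hypotheses (la1 : forall n, 1 |> n = n) (ra1 : forall n, n <| 1 = n).
Hypotheses (laM : forall g h n, (g * h) |> n = g |> h |> n).
Hypotheses (raM : forall n g h, n <| (g * h) = n <| g <| h).
Hypothesis lara : forall g n h, g |> (n <| h) = (g |> n) <| h.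
Hypothesis laD : forall g n m, g |> (n * m) = (g |> n) * (g |> m).
Hypothesis raD : forall n m g, (n * m) <| g = (n <| g) * (m <| g).

Definition sdp_mul (x y : N * G) : N * G :=
  ((x.1 <| y.2) * (x.2 |> y.1), x.2 * y.2).
Definition sdp_inv (x : N * G) : N * G :=
  (x.2^-1 |> x.1^-1 <| x.2^-1, x.2^-1).

Variables (r : N -> N) (b : G -> G).

Definition rb_op (M : groupType) (f : M -> M) :=
  forall x y, f x * f y = f (x * f x * y * (f x)^-1).

Definition btilde (x : N * G) : N * G := (b x.2 |> r x.1 <| b x.2, b x.2).

(** This is [rb_op] for [btilde], spelled out for the group of pairs with product [sdp_mul] and
    inverse [sdp_inv]. *)
Definition sdp_rb := forall x y, sdp_mul (btilde x) (btilde y) =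
  btilde (sdp_mul (sdp_mul (sdp_mul x (btilde x)) y) (sdp_inv (btilde x))).

(** The value of [compat1] at the points [n], [m], [g] of its three tensor slots. *)
Definition point_compat1 := forall n m g,
  r (((n * r n) <| g) * m * (g |> (r n)^-1)) = ((b g)^-1 |> r n) * r m.

(** The value of [compat2] with [g] on the slot in [H] and [m] on the slot in [C]. *)
Definition point_compat2 := forall m g,
  r ((g * b g) |> m <| (b g)^-1) = r m <| (b g)^-1.

(** At [x = y = 1] the argument on the right collapses to [1], so [f 1] is an idempotent of a
    group. *)
Lemma rb_op1 (M : groupType) (f : M -> M) : rb_op f -> f 1 = 1.
Proof.
move=> h; apply: (mulgI (f 1)); by rewrite (h 1 1) !(mulg1, mul1g) mulgV.

Qed.

Lemma la_one g : g |> 1 = 1.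
Proof. by apply: (mulgI (g |> 1)); rewrite -laD !mulg1. Qed.

Lemma ra_one g : 1 <| g = 1.
Proof. by apply: (mulgI (1 <| g)); rewrite -raD !mulg1. Qed.

Lemma la_inv g n : g |> n^-1 = (g |> n)^-1.
Proof. by apply: (mulgI (g |> n)); rewrite -laD !mulgV la_one. Qed.

Lemma ra_inv n g : n^-1 <| g = (n <| g)^-1.
Proof. by apply: (mulgI (n <| g)); rewrite -raD !mulgV ra_one. Qed.

Hypothesis rb_b : rb_op b.

(** The second coordinates of the two sides of [sdp_rb] agree by [rb_b]. Both first coordinates
    carry the action of [b g * b h] from the left and from the right; acting by its inverse on both
    sides removes it. *)
Lemma sdp_rbE : sdp_rb <-> forall n m g h,
  r (((n * ((g * b g) |> r n)) <| (b g * h * (b g)^-1))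
     * ((g * b g) |> m <| (b g)^-1) * ((g * b g * h) |> (r n)^-1))
  = ((b h)^-1 |> r n) * (r m <| (b g)^-1).
Proof.
(* [A] is the first coordinate of the argument of [btilde] on the right of [sdp_rb]. [Q] is the
   first coordinate of the left side with the two-sided action of [b g * b h] taken off. *)
pose A n m g h := ((n * ((g * b g) |> r n)) <| (b g * h * (b g)^-1))
  * ((g * b g) |> m <| (b g)^-1) * ((g * b g * h) |> (r n)^-1).
pose Q n m g h := ((b h)^-1 |> r n) * (r m <| (b g)^-1).
have eA n m g h : sdp_mul (sdp_mul (sdp_mul (n, g) (btilde (n, g))) (m, h))
    (sdp_inv (btilde (n, g))) = (A n m g h, g * b g * h * (b g)^-1).
  rewrite /sdp_mul /btilde /sdp_inv /A /=; congr pair.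
  rewrite !(laM, raM, laD, raD, la_inv, ra_inv, lara, mulgA).
  rewrite -!(lara, laM, raM).
  by rewrite mulgV ra1 mulgVK.
have eQ n m g h : sdp_mul (btilde (n, g)) (btilde (m, h)) =
    ((b g * b h) |> Q n m g h <| (b g * b h), b g * b h).
  rewrite /sdp_mul /btilde /Q /=; congr pair.
  by rewrite laD raD -!(lara, laM, raM) mulgK mulKg.
have step n m g h : sdp_mul (btilde (n, g)) (btilde (m, h)) =
    btilde (sdp_mul (sdp_mul (sdp_mul (n, g) (btilde (n, g))) (m, h))
      (sdp_inv (btilde (n, g)))) <-> r (A n m g h) = Q n m g h.
  rewrite eA eQ /btilde /= -rb_b; split => [[e]|->//].
  have /(congr1 (fun z => (b g * b h)^-1 |> z <| (b g * b h)^-1)) := e.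
  by rewrite -!(lara, laM, raM) !mulVg !mulgV !la1 !ra1.
split => [h n m g g'|h [n g] [m g']]; first exact/step.
by apply/step; apply: h.
Qed.

(* Twisting by [r (g b(g) |> x <| b(g)^-1) = r x <| b(g)^-1] turns the general
   identity for [(n, g)] into the first compatibility for
   [p = (g b(g))^-1 |> n <| b(g)]. *)
Lemma sdp_rb_iff :
  sdp_rb <-> [/\ rb_op r, point_compat1 & point_compat2].
Proof.
have b1 := rb_op1 rb_b.
split => [/sdp_rbE h|[hr h1 h2]].
  (* The three conditions are specialisations: first argument [(n, 1)] gives the first
     compatibility, its case [g = 1] gives the identity for [r], and the pairs [(1, g)], [(m, 1)]
     give the second compatibility. *)
  have h1 : point_compat1.
    move=> n m g; have := h n m 1 g.
    by rewrite b1 !(mulg1, mul1g, invg1, la1, ra1) => ->.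
  have hr : rb_op r.
    move=> n m; have := h1 n m 1.
    by rewrite b1 invg1 !la1 ra1 => ->.
  split=> // m g; have := h 1 m g 1.
  by rewrite b1 (rb_op1 hr) !(mulg1, mul1g, invg1, la_one, ra_one).
apply/sdp_rbE => n m g h; pose p := (g * b g)^-1 |> n <| b g.
have np : n = (g * b g) |> p <| (b g)^-1.
  by rewrite /p -!(lara, laM, raM) mulgV mulgV la1 ra1.
have rp : r p = r n <| b g by rewrite np h2 -raM mulVg ra1.
have -> : ((b h)^-1 |> r n) * (r m <| (b g)^-1) =
   (((b h)^-1 |> r p) * r m) <| (b g)^-1.
  by rewrite raD rp -lara -raM mulgV ra1.
rewrite -h1 -h2; congr r.
rewrite rp {1}np !(laM, raM, laD, raD, la_inv, ra_inv, lara, mulgA).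
rewrite -!(lara, laM, raM).
by rewrite !mulgV ra1 mulVKg.
Qed.

End GroupLevel.

(** * Sums over lists of Sweedler components *)

Lemma sum_sbind (T U : Type) (V : nmodType) (s : seq T) (f : T -> seq U)
    (F : U -> V) :
  \sum_(p <- sbind s f) F p = \sum_(x <- s) \sum_(p <- f x) F p.
Proof.
rewrite /sbind; elim: s => [|x s IH] /=; first by rewrite !big_nil.
by rewrite big_cat big_cons IH.
Qed.

Lemma sum_sbind2 (T U W : Type) (V : nmodType) (s : seq T) (t : T -> seq U)
    (e : T -> U -> W) (F : W -> V) :
  \sum_(x <- sbind s (fun p => sbind (t p) (fun q => [:: e p q]))) F x =
  \sum_(p <- s) \sum_(q <- t p) F (e p q).
Proof.
rewrite sum_sbind; apply: eq_bigr => p _; rewrite sum_sbind.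
by apply: eq_bigr => q _; rewrite big_seq1.
Qed.

Lemma sum_sm_mul (k : fieldType) (A B : comAlgType k) (s t : seq (A * B))
    (U : nmodType) (f : A -> B -> U) :
  \sum_(p <- sm_mul s t) f p.1 p.2 =
  \sum_(p <- s) \sum_(q <- t) f (p.1 * q.1) (p.2 * q.2).
Proof. exact: sum_sbind2. Qed.

(** * Closure properties of linear maps *)

Section LinearMaps.
Variable k : fieldType.

Section Lin.
Variables (A U : lmodType k) (f : A -> U).
Hypothesis Lf : lin f.

Lemma linD x y : f (x + y) = f x + f y.
Proof. by rewrite -[x]scale1r Lf !scale1r. Qed.

Lemma lin0 : f 0 = 0.
Proof. by apply: (addrI (f 0)); rewrite -linD !addr0. Qed.

Lemma linZ a x : f (a *: x) = a *: f x.
Proof. by rewrite -[a *: x]addr0 Lf lin0 addr0. Qed.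

Lemma lin_sum (I : Type) (s : seq I) (F : I -> A) :
  f (\sum_(i <- s) F i) = \sum_(i <- s) f (F i).
Proof. exact: (big_morph f linD lin0). Qed.
End Lin.

Lemma lin_bigsum (A U : lmodType k) (I : Type) (s : seq I) (F : A -> I -> U) :
  (forall i, lin (F^~ i)) -> lin (fun a => \sum_(i <- s) F a i).
Proof.
move=> LF a x y; rewrite scaler_sumr -big_split /=.
by apply: eq_bigr => i _; rewrite LF.
Qed.

Lemma lin_comp (A B U : lmodType k) (f : B -> U) (g : A -> B) :
  lin f -> lin g -> lin (fun x => f (g x)).
Proof. by move=> Lf Lg a x y; rewrite Lg Lf. Qed.

Lemma lin_scaler (A U : lmodType k) (f : A -> k) (u : U) :
  lin (U := k^o) f -> lin (fun x => f x *: u).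
Proof. by move=> Lf a x y; rewrite Lf scalerDl scalerA. Qed.

Lemma lin_mull (A : lmodType k) (K : comAlgType k) (f : A -> K) u :
  lin f -> lin (fun x => u * f x).
Proof. by move=> Lf a x y; rewrite Lf mulrDr scalerAr. Qed.

Lemma lin_mulr (A : lmodType k) (K : comAlgType k) (f : A -> K) u :
  lin f -> lin (fun x => f x * u).
Proof. by move=> Lf a x y; rewrite Lf mulrDl scalerAl. Qed.

Lemma lin_id (A : lmodType k) : lin (@id A).
Proof. by []. Qed.

End LinearMaps.

(* An augmentation makes [1 <> 0] in tensor products, as [comAlgType] demands. *)
Record augAlg (k : fieldType) := AugAlg {
  aug_alg :> comAlgType k;
  aug : aug_alg -> k;
  aug_lin : lin (U := k^o) aug;
  aug1 : aug 1 = 1 }.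

(** * The tensor product of two augmented algebras as a commutative algebra *)

Section TensorProduct.
Variables (k : fieldType) (A B : augAlg k).
Implicit Types s t : seq (A * B).

Definition tens_rel s t := `[< teq2 s t >].

Lemma tens_rel_refl : reflexive tens_rel.
Proof. by move=> s; apply/asboolP. Qed.

Lemma tens_rel_sym : symmetric tens_rel.
Proof. by move=> s t; apply/asboolP/asboolP => e U f Lf; rewrite e. Qed.

Lemma tens_rel_trans : transitive tens_rel.
Proof.
by move=> t s u /asboolP e /asboolP e'; apply/asboolP => U f Lf; rewrite e ?e'.
Qed.

Canonical tens_equiv := EquivRel tens_rel tens_rel_refl tens_rel_sym tens_rel_trans.

Definition tens := {eq_quot tens_equiv}.
HB.instance Definition _ := Choice.on tens.
HB.instance Definition _ := EqQuotient.on tens.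

Definition class s : tens := \pi_tens s.

Lemma classP s t : class s = class t <-> teq2 s t.
Proof.
rewrite /class; split => [/eqP|e].
  by rewrite piE => /asboolP.
by apply/eqP; rewrite piE; apply/asboolP.
Qed.

Lemma classE (x : tens) : x = class (repr x).
Proof. by rewrite /class reprK. Qed.

Lemma repr_class s : teq2 (repr (class s)) s.
Proof. by apply/classP; rewrite -classE. Qed.

Definition lift (U : lmodType k) (f : A -> B -> U) (x : tens) : U :=
  \sum_(p <- repr x) f p.1 p.2.

(** The universal property: [teq2] is tested on exactly the bilinear maps, so the choice of
    representative in [lift] does not matter. *)
Lemma lift_class (U : lmodType k) (f : A -> B -> U) s : bilin f ->
  lift f (class s) = \sum_(p <- s) f p.1 p.2.
Proof. exact: repr_class. Qed.

Definition tadd (x y : tens) := class (repr x ++ repr y).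
Definition tscale (a : k) (x : tens) := class [seq (a *: p.1, p.2) | p <- repr x].
Definition tmul (x y : tens) := class (sm_mul (repr x) (repr y)).
Definition tzero := class [::].
Definition topp := tscale (-1).
Definition tone := class [:: (1, 1)].

Lemma tadd_class s t : tadd (class s) (class t) = class (s ++ t).
Proof. by apply/classP => U f Lf; rewrite !big_cat /= !(repr_class _ Lf). Qed.

Lemma tscale_class a s :
  tscale a (class s) = class [seq (a *: p.1, p.2) | p <- s].
Proof.
apply/classP => U f Lf; rewrite !big_map /=.
have h t : \sum_(p <- t) f (a *: p.1) p.2 = a *: \sum_(p <- t) f p.1 p.2.
  by rewrite scaler_sumr; apply: eq_bigr => p _; rewrite (linZ (Lf.1 _)).
by rewrite !h (repr_class _ Lf).
Qed.

Lemma bilin_mull (U : lmodType k) (f : A -> B -> U) a b :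
  bilin f -> bilin (fun x y => f (a * x) (b * y)).
Proof.
case=> L1 L2; split => [y|x] c u v; rewrite mulrDr -scalerAr ?L1 //.
exact: L2.
Qed.

Lemma bilin_sum_mul s (U : lmodType k) (f : A -> B -> U) : bilin f ->
  bilin (fun a b => \sum_(p <- s) f (p.1 * a) (p.2 * b)).
Proof.
move=> Lf; split => [b|a].
  by apply: lin_bigsum => p; apply: (bilin_mull p.1 p.2 Lf).1.
by apply: lin_bigsum => p; apply: (bilin_mull p.1 p.2 Lf).2.
Qed.

Lemma sm_mulC s t : teq2 (sm_mul s t) (sm_mul t s).
Proof.
move=> U f Lf; rewrite !sum_sm_mul exchange_big; apply: eq_bigr => p _.
by apply: eq_bigr => q _; rewrite [p.1 * _]mulrC [p.2 * _]mulrC.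
Qed.

(** With one factor fixed, a bilinear test map on products is a bilinear test map in the other
    factor ([bilin_sum_mul]); commutativity exchanges the roles of the factors. *)
Lemma teq2_mul s s' t t' :
  teq2 s s' -> teq2 t t' -> teq2 (sm_mul s t) (sm_mul s' t').
Proof.
have h (u v v' : seq (A * B)) : teq2 v v' -> teq2 (sm_mul u v) (sm_mul u v').
  move=> e U f Lf; rewrite !sum_sm_mul exchange_big [RHS]exchange_big /=.
  exact: e (bilin_sum_mul u Lf).
move=> e e' U f Lf; rewrite (h _ _ _ e' _ _ Lf) sm_mulC // (h _ _ _ e _ _ Lf).
by rewrite sm_mulC.
Qed.

Lemma tmul_class s t : tmul (class s) (class t) = class (sm_mul s t).
Proof. by apply/classP; apply: teq2_mul; apply: repr_class. Qed.

Lemma taddA : associative tadd.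
Proof.
move=> x y z; rewrite (classE x) (classE y) (classE z) !tadd_class.
by rewrite catA.
Qed.

Lemma taddC : commutative tadd.
Proof.
move=> x y; rewrite (classE x) (classE y) !tadd_class; apply/classP => U f _.
by rewrite !big_cat /= addrC.
Qed.

Lemma tadd0 : left_id tzero tadd.
Proof. by move=> x; rewrite (classE x) tadd_class. Qed.

Lemma taddN : left_inverse tzero topp tadd.
Proof.
move=> x; rewrite (classE x) /topp tscale_class tadd_class; apply/classP.
move=> U f Lf; rewrite big_cat big_map big_nil /= -big_split big1 //= => p _.
by rewrite (linZ (Lf.1 _)) scaleN1r addNr.
Qed.

HB.instance Definition _ := GRing.isZmodule.Build tens taddA taddC tadd0 taddN.

Lemma tmulA : associative tmul.
Proof.
move=> x y z; rewrite (classE x) (classE y) (classE z) !tmul_class.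
apply/classP => U f Lf; rewrite !sum_sm_mul sum_sbind; apply: eq_bigr => p _.
rewrite (sum_sm_mul _ _ (fun a b => f (p.1 * a) (p.2 * b))) sum_sbind.
by apply: eq_bigr => q _; rewrite big_seq1; apply: eq_bigr => r _; rewrite !mulrA.
Qed.

Lemma tmulC : commutative tmul.
Proof.
move=> x y; rewrite (classE x) (classE y) !tmul_class.
by apply/classP; apply: sm_mulC.
Qed.

Lemma tmul1 : left_id tone tmul.
Proof.
move=> x; rewrite (classE x) tmul_class; apply/classP => U f Lf.
by rewrite sum_sm_mul big_seq1; apply: eq_bigr => p _; rewrite !mul1r.
Qed.

Lemma tmulDl : left_distributive tmul tadd.
Proof.
move=> x y z; rewrite (classE x) (classE y) (classE z).
rewrite tadd_class !tmul_class tadd_class; apply/classP => U f Lf.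
by rewrite big_cat !sum_sm_mul big_cat.
Qed.

Definition tens_aug : tens -> k := lift (U := k^o) (fun a b => aug a * aug b).

Lemma bilin_aug : bilin (U := k^o) (fun (a : A) (b : B) => aug a * aug b).
Proof.
split => [b|a] c x y; rewrite (aug_lin c x y) /GRing.scale /=.
  by rewrite mulrDl mulrA.
by rewrite mulrDr mulrCA.
Qed.

Lemma tone_neq0 : tone != tzero.
Proof.
apply/eqP => /classP /(_ _ _ bilin_aug).
by rewrite big_seq1 big_nil !aug1 mulr1 => /eqP; rewrite oner_eq0.
Qed.

HB.instance Definition _ :=
  GRing.Zmodule_isComNzRing.Build tens tmulA tmulC tmul1 tmulDl tone_neq0.

Lemma tscaleA a b x : tscale a (tscale b x) = tscale (a * b) x.
Proof.
rewrite (classE x) !tscale_class -map_comp; congr class.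
by apply: eq_map => p /=; rewrite scalerA.
Qed.

Lemma tscale1 : left_id 1 tscale.
Proof.
move=> x; rewrite {1}(classE x) !tscale_class [RHS]classE; congr class.
by rewrite -[RHS]map_id; apply: eq_map => -[a b] /=; rewrite scale1r.
Qed.

Lemma tscaleDr : right_distributive tscale +%R.
Proof.
move=> a x y; rewrite (classE x) (classE y) /GRing.add /=.
by rewrite tadd_class !tscale_class tadd_class map_cat.
Qed.

Lemma tscaleDl x : {morph tscale^~ x : a b / a + b}.
Proof.
move=> a b; rewrite (classE x) [RHS]/GRing.add /= !tscale_class tadd_class.
apply/classP => U f Lf; rewrite big_cat !big_map /= -big_split /=.
by apply: eq_bigr => p _; rewrite scalerDl (linD (Lf.1 _)).
Qed.

HB.instance Definition _ :=
  GRing.Zmodule_isLmodule.Build k tens tscaleA tscale1 tscaleDr tscaleDl.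

Lemma tscaleAl (a : k) (x y : tens) : a *: (x * y) = (a *: x) * y.
Proof.
rewrite (classE x) (classE y) /GRing.scale /GRing.mul /=.
rewrite tscale_class !tmul_class tscale_class; apply/classP => U f Lf.
rewrite sum_sm_mul big_map /=.
rewrite big_map (sum_sm_mul _ _ (fun u v => f (a *: u) v)).
by apply: eq_bigr => p _; apply: eq_bigr => q _; rewrite scalerAl.
Qed.

HB.instance Definition _ := GRing.Lmodule_isLalgebra.Build k tens tscaleAl.
HB.instance Definition _ := GRing.Lalgebra_isComAlgebra.Build k tens.

Lemma lin_lift (U : lmodType k) (f : A -> B -> U) : bilin f -> lin (lift f).
Proof.
move=> Lf a x y; rewrite (classE x) (classE y) /GRing.scale /GRing.add /=.
rewrite tscale_class tadd_class !lift_class // big_cat big_map /=.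
congr (_ + _); rewrite [RHS]scaler_sumr.
by apply: eq_bigr => p _; rewrite (linZ (Lf.1 _)).
Qed.

Lemma tens_aug_lin : lin (U := k^o) tens_aug.
Proof. exact: lin_lift bilin_aug. Qed.

Lemma tens_aug1 : tens_aug 1 = 1.
Proof. by rewrite [LHS](lift_class _ bilin_aug) big_seq1 !aug1 mulr1. Qed.

(** Being augmented again, tensor products can be iterated to reach three and four factors. *)
Canonical tens_augAlg := AugAlg tens_aug_lin tens_aug1.

Definition tinl (a : A) : tens := class [:: (a, 1)].
Definition tinr (b : B) : tens := class [:: (1, b)].

Lemma tinlr a b : tinl a * tinr b = class [:: (a, b)].
Proof. by rewrite [LHS]tmul_class /sm_mul /sbind /= mulr1 mul1r. Qed.

Lemma lift_tinlr (U : lmodType k) (f : A -> B -> U) a b : bilin f ->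
  lift f (tinl a * tinr b) = f a b.
Proof. by move=> Lf; rewrite tinlr lift_class // big_seq1. Qed.

End TensorProduct.

(** * Algebra maps, and detection of tensor identities on points *)

Section AlgebraMaps.
Variable k : fieldType.

(** A [K]-point of [A]; for [K = A] this is convertible to [alg_map]. *)
Definition amap (A K : comAlgType k) (f : A -> K) : Prop :=
  [/\ lin f, {morph f : x y / x * y} & f 1 = 1].

Lemma amap_comp (A K L : comAlgType k) (f : K -> L) (g : A -> K) :
  amap f -> amap g -> amap (fun x => f (g x)).
Proof.
move=> [Lf Mf f1] [Lg Mg g1]; split; first exact: lin_comp.
  by move=> x y; rewrite Mg Mf.
by rewrite g1 f1.
Qed.

Section TensorMaps.
Variables A B : augAlg k.

Lemma amap_tinl : amap (@tinl k A B).
Proof.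
split=> [a x y|x y|//]; last by rewrite [RHS]tmul_class /sm_mul /sbind /= mulr1.
rewrite /GRing.scale /GRing.add /= [tscale _ _]tscale_class tadd_class.
by apply/classP => U f Lf; rewrite big_cat /= !big_seq1 /= (linD (Lf.1 _)).
Qed.

Lemma amap_tinr : amap (@tinr k A B).
Proof.
split=> [a x y|x y|//]; last by rewrite [RHS]tmul_class /sm_mul /sbind /= mulr1.
rewrite /GRing.scale /GRing.add /= [tscale _ _]tscale_class tadd_class.
apply/classP => U f Lf; rewrite big_cat /= !big_seq1 /= (linD (Lf.2 _)).
by rewrite (linZ (Lf.2 _)) (linZ (Lf.1 _)).
Qed.
End TensorMaps.

Lemma bilin_mul (A B : lmodType k) (K : comAlgType k) (f : A -> K) (g : B -> K) :
  lin f -> lin g -> bilin (fun a b => f a * g b).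
Proof. by move=> Lf Lg; split => u; [exact: lin_mulr|exact: lin_mull]. Qed.

Lemma trilin_mul (A B C : lmodType k) (K : comAlgType k)
    (f : A -> K) (g : B -> K) (h : C -> K) :
  lin f -> lin g -> lin h -> trilin (fun a b c => f a * g b * h c).
Proof.
move=> Lf Lg Lh; split => u v; last exact: lin_mull.
  by do 2![apply: lin_mulr].
by apply: lin_mulr; apply: lin_mull.
Qed.

Lemma quadlin_mul (A B C D : lmodType k) (K : comAlgType k)
    (f : A -> K) (g : B -> K) (h : C -> K) (l : D -> K) :
  lin f -> lin g -> lin h -> lin l ->
  quadlin (fun a b c d => f a * g b * (h c * l d)).
Proof.
move=> Lf Lg Lh Ll; split => u v w.
- by do 2![apply: lin_mulr].
- by apply: lin_mulr; apply: lin_mull.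
- by apply: lin_mull; apply: lin_mulr.
- by do 2![apply: lin_mull].
Qed.

(** The inclusions [tinl] and [tinr] form the universal point: the sum of their products over a list
    is the tensor itself, and every bilinear map factors linearly through it. *)
Lemma teq2_points (A B : augAlg k) (s t : seq (A * B)) :
  (forall (K : comAlgType k) (f : A -> K) (g : B -> K), amap f -> amap g ->
    \sum_(p <- s) f p.1 * g p.2 = \sum_(p <- t) f p.1 * g p.2) ->
  teq2 s t.
Proof.
move=> e U F LF.
have LL := lin_lift LF.
have h u : \sum_(p <- u) F p.1 p.2 =
    lift F (\sum_(p <- u) tinl B p.1 * tinr A p.2).
  by rewrite (lin_sum LL); apply: eq_bigr => p _; rewrite lift_tinlr.
by rewrite !h e //; [exact: amap_tinl|exact: amap_tinr].
Qed.

(** The universal point now takes values in the tensor product of [AB] with [C]; a trilinear [F]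
    becomes the bilinear [F'] by lifting in its first two arguments. *)
Lemma teq3_points (A B C : augAlg k) (s t : seq (A * B * C)) :
  (forall (K : comAlgType k) (f : A -> K) (g : B -> K) (h : C -> K),
    amap f -> amap g -> amap h ->
    \sum_(p <- s) f p.1.1 * g p.1.2 * h p.2 =
    \sum_(p <- t) f p.1.1 * g p.1.2 * h p.2) ->
  teq3 s t.
Proof.
move=> e U F [L1 L2 L3].
pose AB := tens_augAlg A B.
pose F' (x : AB) c := lift (fun a b => F a b c) x.
have LF c : bilin (fun a b => F a b c) by split.
have LF' : bilin F'.
  split => [c|x]; first exact: lin_lift (LF c).
  exact: (lin_bigsum _ (fun p => L3 p.1 p.2)).
have h u : \sum_(p <- u) F p.1.1 p.1.2 p.2 = lift F' (\sum_(p <- u)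
    tinl C (tinl B p.1.1 : AB) * tinl C (tinr A p.1.2 : AB) * tinr AB p.2).
  rewrite (lin_sum (lin_lift LF')); apply: eq_bigr => p _.
  have [_ M _] := @amap_tinl AB C.
  by rewrite -M lift_tinlr // /F' lift_tinlr.
rewrite !h; congr (lift F' _).
apply: (e _ (fun a => tinl C (tinl B a : AB)) (fun b => tinl C (tinr A b : AB))).
- exact: amap_comp (@amap_tinl AB C) (@amap_tinl A B).
- exact: amap_comp (@amap_tinl AB C) (@amap_tinr A B).
- exact: amap_tinr.
Qed.

(** The factors are grouped in two pairs, as they occur for two points of the smash coproduct. *)
Lemma teq4_points (A B C D : augAlg k) (s t : seq (A * B * C * D)) :
  (forall (K : comAlgType k) (f : A -> K) (g : B -> K) (h : C -> K) (l : D -> K),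
    amap f -> amap g -> amap h -> amap l ->
    \sum_(p <- s) f p.1.1.1 * g p.1.1.2 * (h p.1.2 * l p.2) =
    \sum_(p <- t) f p.1.1.1 * g p.1.1.2 * (h p.1.2 * l p.2)) ->
  teq4 s t.
Proof.
move=> e U F [L1 L2 L3 L4].
pose AB := tens_augAlg A B; pose CD := tens_augAlg C D.
pose F' (x : AB) (y : CD) := lift (fun a b => lift (fun c d => F a b c d) y) x.
have LF a b : bilin (fun c d => F a b c d) by split.
have LG y : bilin (fun a b => lift (fun c d => F a b c d) y).
  split => [b|a]; apply: lin_bigsum => p; [exact: L1|exact: L2].
have LF' : bilin F'.
  split => [y|x]; first exact: lin_lift (LG y).
  exact: (lin_bigsum _ (fun p => lin_lift (LF p.1 p.2))).
have h u : \sum_(p <- u) F p.1.1.1 p.1.1.2 p.1.2 p.2 = lift F' (\sum_(p <- u)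
    tinl CD (tinl B p.1.1.1 : AB) * tinl CD (tinr A p.1.1.2 : AB)
    * (tinr AB (tinl D p.1.2 : CD) * tinr AB (tinr C p.2 : CD))).
  rewrite (lin_sum (lin_lift LF')); apply: eq_bigr => p _.
  have [[_ M _] [_ M' _]] := (@amap_tinl AB CD, @amap_tinr AB CD).
  by rewrite -M -M' lift_tinlr // /F' lift_tinlr // lift_tinlr.
rewrite !h; congr (lift F' _).
apply: (e _ (fun a => tinl CD (tinl B a : AB)) (fun b => tinl CD (tinr A b : AB))
  (fun c => tinr AB (tinl D c : CD)) (fun d => tinr AB (tinr C d : CD))).
- exact: amap_comp (@amap_tinl AB CD) (@amap_tinl A B).
- exact: amap_comp (@amap_tinl AB CD) (@amap_tinr A B).
- exact: amap_comp (@amap_tinr AB CD) (@amap_tinl C D).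
- exact: amap_comp (@amap_tinr AB CD) (@amap_tinr C D).
Qed.

End AlgebraMaps.

(** * Hopf algebra identities in summed form, and multiplicativity of the antipode *)

Section HopfAlgebra.
Variables (k : fieldType) (A : comAlgType k) (h : hopf_ops A).
Hypothesis ax : hopf_algebra h.
Implicit Types x y : A.

(** Sweedler representatives depend linearly on the element only up to [teq2]; genuine linearity
    appears after a bilinear map is applied. *)
Lemma lin2_sum (V X Y U : lmodType k) (s : V -> seq (X * Y)) (f : X -> Y -> U) :
  lin2 s -> bilin f -> lin (fun v => \sum_(p <- s v) f p.1 p.2).
Proof.
move=> Ls Lf a u v; rewrite (Ls a u v _ _ Lf) big_cat big_map scaler_sumr /=.
by congr (_ + _); apply: eq_bigr => p _; rewrite (linZ (Lf.1 _)).
Qed.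

Lemma cop_lin : lin2 (cop h). Proof. by case: ax => -[]. Qed.

Lemma cop_mul (U : lmodType k) (f : A -> A -> U) x y : bilin f ->
  \sum_(p <- cop h (x * y)) f p.1 p.2 =
  \sum_(p <- cop h x) \sum_(q <- cop h y) f (p.1 * q.1) (p.2 * q.2).
Proof.
by move=> Lf; case: ax => -[_ M] _ _ _ _; rewrite (M x y _ _ Lf) sum_sbind2.
Qed.

Lemma cop_one (U : lmodType k) (f : A -> A -> U) : bilin f ->
  \sum_(p <- cop h 1) f p.1 p.2 = f 1 1.
Proof. by move=> Lf; case: ax => _ [e _] _ _ _; rewrite (e _ _ Lf) big_seq1. Qed.

Lemma coassoc (U : lmodType k) (f : A -> A -> A -> U) x : trilin f ->
  \sum_(p <- cop h x) \sum_(q <- cop h p.1) f q.1 q.2 p.2 =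
  \sum_(p <- cop h x) \sum_(q <- cop h p.2) f p.1 q.1 q.2.
Proof.
by move=> Lf; case: ax => _ [_ /(_ x _ _ Lf)]; rewrite !sum_sbind2.
Qed.

Lemma cou_lin : lin (U := k^o) (cou h). Proof. by case: ax => _ _ []. Qed.
Lemma cou_mul x y : cou h (x * y) = cou h x * cou h y.
Proof. by case: ax => _ _ [_ []]. Qed.
Lemma cou_one : cou h 1 = 1. Proof. by case: ax => _ _ [_ []]. Qed.
Lemma counitl x : \sum_(p <- cop h x) cou h p.1 *: p.2 = x.
Proof. by case: ax => _ _ _ /(_ x) []. Qed.
Lemma counitr x : \sum_(p <- cop h x) cou h p.2 *: p.1 = x.
Proof. by case: ax => _ _ _ /(_ x) []. Qed.
Lemma antip_lin : lin (antip h). Proof. by case: ax => _ _ _ _ []. Qed.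
Lemma antipl x : \sum_(p <- cop h x) antip h p.1 * p.2 = cou h x *: 1.
Proof. by case: ax => _ _ _ _ [_ /(_ x)] []. Qed.
Lemma antipr x : \sum_(p <- cop h x) p.1 * antip h p.2 = cou h x *: 1.
Proof. by case: ax => _ _ _ _ [_ /(_ x)] []. Qed.

Definition hopf_aug : augAlg k := AugAlg cou_lin cou_one.

Let S := antip h.

Lemma antip_one : S 1 = 1.
Proof.
have := antipl 1; rewrite cou_one scale1r.
by rewrite (cop_one (bilin_mul antip_lin (@lin_id k A))) mulr1.
Qed.

(** Convolution of maps from the coalgebra [A (x) A] to [A], in bilinear form. *)
Definition conv2 (f g : A -> A -> A) x y :=
  \sum_(p <- cop h x) \sum_(q <- cop h y) f p.1 q.1 * g p.2 q.2.

(** Coassociativity is applied to [x] first, with the sums over [y] inside the trilinear map, and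
    then to [y] for fixed components of [x]. *)
Lemma conv2A (f g l : A -> A -> A) x y : bilin f -> bilin g -> bilin l ->
  conv2 (conv2 f g) l x y = conv2 f (conv2 g l) x y.
Proof.
move=> [f1 f2] [g1 g2] [l1 l2]; rewrite /conv2.
transitivity (\sum_(p <- cop h x) \sum_(p' <- cop h p.1)
    \sum_(q <- cop h y) \sum_(q' <- cop h q.1)
      f p'.1 q'.1 * g p'.2 q'.2 * l p.2 q.2).
  apply: eq_bigr => p _; rewrite exchange_big; apply: eq_bigr => q _ /=.
  rewrite mulr_suml; apply: eq_bigr => p' _; rewrite mulr_suml.
  by apply: eq_bigr.
rewrite (coassoc (f := fun a b c => \sum_(q <- cop h y) \sum_(q' <- cop h q.1)
  f a q'.1 * g b q'.2 * l c q.2)); last first.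
  split => u v; apply: lin_bigsum => q; apply: lin_bigsum => q'.
  - by apply: lin_mulr; apply: lin_mulr; apply: f1.
  - by apply: lin_mulr; apply: lin_mull; apply: g1.
  - by apply: lin_mull; apply: l1.
apply: eq_bigr => p _.
transitivity (\sum_(p' <- cop h p.2) \sum_(q <- cop h y) \sum_(q' <- cop h q.2)
    f p.1 q.1 * (g p'.1 q'.1 * l p'.2 q'.2)).
  apply: eq_bigr => p' _.
  rewrite (coassoc (f := fun a b c => f p.1 a * g p'.1 b * l p'.2 c)).
    by apply: eq_bigr => q _; apply: eq_bigr => q' _; rewrite mulrA.
  by apply: trilin_mul; [apply: f2|apply: g2|apply: l2].
rewrite exchange_big; apply: eq_bigr => q _ /=; rewrite mulr_sumr.
by apply: eq_bigr => p' _; rewrite mulr_sumr.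
Qed.

Let unit2 x y : A := (cou h x * cou h y) *: 1.

Lemma conv2_unitl (f : A -> A -> A) x y : bilin f -> conv2 unit2 f x y = f x y.
Proof.
move=> [f1 f2]; rewrite -{2}(counitl x) -{2}(counitl y) (lin_sum (f1 _)).
apply: eq_bigr => p _; rewrite (lin_sum (f2 _)); apply: eq_bigr => q _.
by rewrite (linZ (f1 _)) (linZ (f2 _)) scalerA -scalerAl mul1r.
Qed.

Lemma conv2_unitr (f : A -> A -> A) x y : bilin f -> conv2 f unit2 x y = f x y.
Proof.
move=> [f1 f2]; rewrite -{2}(counitr x) -{2}(counitr y) (lin_sum (f1 _)).
apply: eq_bigr => p _; rewrite (lin_sum (f2 _)); apply: eq_bigr => q _.
by rewrite (linZ (f1 _)) (linZ (f2 _)) scalerA -scalerAr mulr1.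
Qed.

(* Both sides are convolution inverse to the multiplication of [A] among the
   bilinear maps [A * A -> A]. *)
Lemma antip_mul x y : S (x * y) = S x * S y.
Proof.
have LS := antip_lin.
pose F x y := S (x * y); pose M x y : A := x * y; pose T x y := S x * S y.
have LM : bilin M by apply: bilin_mul; apply: lin_id.
have LF : bilin F by split => u; apply: (lin_comp LS); [apply: LM.1|apply: LM.2].
have LT : bilin T by apply: bilin_mul.
have FM : conv2 F M = unit2.
  apply: funext => u; apply: funext => v; rewrite /unit2 -cou_mul -antipl.
  by rewrite (cop_mul _ _ (bilin_mul LS (@lin_id k A))).
have MT : conv2 M T = unit2.
  apply: funext => u; apply: funext => v; rewrite /unit2 -scalerA.
  rewrite -[X in _ *: X]mul1r scalerAl -!antipr mulr_suml.
  apply: eq_bigr => p _; rewrite mulr_sumr; apply: eq_bigr => q _.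
  by rewrite mulrACA.
by rewrite -[LHS](conv2_unitr _ _ LF) -MT -conv2A // FM conv2_unitl.
Qed.

Lemma antip_amap : amap S.
Proof. by split; [exact: antip_lin|exact: antip_mul|exact: antip_one]. Qed.

End HopfAlgebra.

(** * The convolution group of points of a commutative Hopf algebra *)

Record pt (k : fieldType) (A : comAlgType k) (h : hopf_ops A)
    (ax : hopf_algebra h) (K : comAlgType k) :=
  Pt { pt_fun :> A -> K; ptP : amap pt_fun }.

Section Points.
Variables (k : fieldType) (A : comAlgType k) (h : hopf_ops A).
Hypothesis ax : hopf_algebra h.

Section PointGroup.
Variable K : comAlgType k.
Local Notation pt := (pt ax K).
Implicit Types f g l : pt.

Lemma pt_eq f g : pt_fun f =1 pt_fun g -> f = g.
Proof.
case: f g => [f pf] [g pg] /= /funext e; rewrite e in pf *.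
by rewrite (Prop_irrelevance pf pg).
Qed.

Lemma pt_lin f : lin f. Proof. by case: (ptP f). Qed.
Lemma pt_mul f x y : f (x * y) = f x * f y. Proof. by case: (ptP f). Qed.
Lemma pt_one f : f 1 = 1. Proof. by case: (ptP f). Qed.

Lemma amap_conv f g : amap (fun x => \sum_(p <- cop h x) f p.1 * g p.2).
Proof.
have Lfg := bilin_mul (pt_lin f) (pt_lin g).
split; first exact: lin2_sum (cop_lin ax) Lfg.
  move=> x y; rewrite (cop_mul ax _ _ Lfg) mulr_suml.
  apply: eq_bigr => p _; rewrite mulr_sumr; apply: eq_bigr => q _.
  by rewrite !pt_mul mulrACA.
by rewrite (cop_one ax Lfg) !pt_one mulr1.
Qed.

Lemma amap_cou : amap (fun x => cou h x *: (1 : K)).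
Proof.
split; first exact: lin_scaler (cou_lin ax).
  by move=> x y; rewrite (cou_mul ax) -scalerA -scalerAl mul1r.
by rewrite (cou_one ax) scale1r.
Qed.

Definition pt_conv f g : pt := Pt ax (amap_conv f g).
Definition pt_cou : pt := Pt ax amap_cou.
Definition pt_antip f : pt := Pt ax (amap_comp (ptP f) (antip_amap ax)).

Lemma pt_convA : associative pt_conv.
Proof.
move=> f g l; apply: pt_eq => x /=; symmetry.
transitivity (\sum_(p <- cop h x) \sum_(q <- cop h p.1) f q.1 * g q.2 * l p.2).
  by apply: eq_bigr => p _; rewrite mulr_suml.
rewrite (coassoc ax _ (trilin_mul (pt_lin f) (pt_lin g) (pt_lin l))).
apply: eq_bigr => p _; rewrite mulr_sumr.
by apply: eq_bigr => q _; rewrite mulrA.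
Qed.

Lemma pt_conv1 : left_id pt_cou pt_conv.
Proof.
move=> f; apply: pt_eq => x /=; rewrite -[in RHS](counitl ax x).
rewrite (lin_sum (pt_lin f)); apply: eq_bigr => p _.
by rewrite (linZ (pt_lin f)) -scalerAl mul1r.
Qed.

Lemma pt_conv1r : right_id pt_cou pt_conv.
Proof.
move=> f; apply: pt_eq => x /=; rewrite -[in RHS](counitr ax x).
rewrite (lin_sum (pt_lin f)); apply: eq_bigr => p _.
by rewrite (linZ (pt_lin f)) -scalerAr mulr1.
Qed.

Lemma pt_convV : left_inverse pt_cou pt_antip pt_conv.
Proof.
move=> f; apply: pt_eq => x /=; rewrite -(pt_one f) -(linZ (pt_lin f)).
rewrite -(antipl ax) (lin_sum (pt_lin f)).
by apply: eq_bigr => p _; rewrite pt_mul.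
Qed.

Lemma pt_convVr : right_inverse pt_cou pt_antip pt_conv.
Proof.
move=> f; apply: pt_eq => x /=; rewrite -(pt_one f) -(linZ (pt_lin f)).
rewrite -(antipr ax) (lin_sum (pt_lin f)).
by apply: eq_bigr => p _; rewrite pt_mul.
Qed.

(** Equality and choice on points are classical. The group law depends on [h] and its axioms, which
    is why [pt] carries both as parameters. *)
HB.instance Definition _ := gen_eqMixin pt.
HB.instance Definition _ := gen_choiceMixin pt.
HB.instance Definition _ :=
  isGroup.Build pt pt_convA pt_conv1 pt_conv1r pt_convV pt_convVr.

Lemma ptME f g x : (f * g)%g x = \sum_(p <- cop h x) f p.1 * g p.2.
Proof. by []. Qed.

Lemma pt1E x : (1 : pt)%g x = cou h x *: 1.
Proof. by []. Qed.

Lemma ptVE f x : (f^-1)%g x = f (antip h x).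
Proof. by []. Qed.

(** Since [R] need not respect [cop], this is a map of sets and in general not a group
    homomorphism. *)
Definition pt_pre (R : A -> A) (HR : amap R) f : pt :=
  Pt ax (amap_comp (ptP f) HR).

Lemma pt_preE (R : A -> A) (HR : amap R) f x : pt_pre HR f x = f (R x).
Proof. by []. Qed.

End PointGroup.

(** Multiplicativity of [f] and [R] splits each summand into one factor per Sweedler leg: [f], [f]
    after [R], [g] on the third leg, and [f] after [R] and the antipode on the fourth. *)
Lemma rota_baxter_eval (K : comAlgType k) (R : A -> A) (HR : amap R)
    (f g : pt ax K) x :
  \sum_(y <- cop3 h x) f (y.1.1.1 * R (y.1.1.2 * antip h y.2)) * g y.1.2 =
  (f * pt_pre HR f * g * (pt_pre HR f)^-1)%g x.
Proof.
have [_ M _] := HR.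
rewrite ptME sum_sbind; apply: eq_bigr => p _.
rewrite ptME mulr_suml sum_sbind; apply: eq_bigr => q _.
rewrite ptME !mulr_suml sum_sbind; apply: eq_bigr => r _.
by rewrite big_seq1 ptVE /= pt_mul M pt_mul; ring.
Qed.

Lemma rota_baxter_points (R : A -> A) (HR : amap R) :
  rota_baxter_coop h R <-> forall K, rb_op (@pt_pre K R HR).
Proof.
split => [[_ e] K f g|e].
  apply: pt_eq => x; rewrite ptME /=.
  have := e x _ _ (bilin_mul (pt_lin f) (pt_lin g)).
  by rewrite !big_map /= (rota_baxter_eval HR).
split=> // x; apply: (@teq2_points _ (hopf_aug ax) (hopf_aug ax)).
move=> K f g Hf Hg; rewrite !big_map.
pose f' : pt ax K := Pt ax Hf; pose g' : pt ax K := Pt ax Hg.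
rewrite (rota_baxter_eval HR f' g').
by have /(congr1 (fun l : pt ax K => l x)) := e K f' g'.
Qed.

End Points.

(** * The coactions of a bicomodule Hopf algebra in summed form *)

Section Smash.
Variables (k : fieldType) (C H : comAlgType k).
Variables (hC : hopf_ops C) (hH : hopf_ops H).
Variables (rl : C -> seq (H * C)) (rr : C -> seq (C * H)).
Hypotheses (aC : hopf_algebra hC) (aH : hopf_algebra hH).
Hypothesis bi : bicomodule_hopf hC hH rl rr.

Lemma rl_lin : lin2 rl. Proof. by case: bi => -[[]]. Qed.
Lemma rr_lin : lin2 rr. Proof. by case: bi => -[_ []]. Qed.

Lemma rl_counit c : \sum_(p <- rl c) cou hH p.1 *: p.2 = c.
Proof. by case: bi => -[[_ [_]]]. Qed.

Lemma rr_counit c : \sum_(p <- rr c) cou hH p.2 *: p.1 = c.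
Proof. by case: bi => -[_ [_ [_]]]. Qed.

Section Multilinear.
Variable U : lmodType k.

Lemma rl_coassoc (f : H -> H -> C -> U) c : trilin f ->
  \sum_(p <- rl c) \sum_(d <- cop hH p.1) f d.1 d.2 p.2 =
  \sum_(p <- rl c) \sum_(q <- rl p.2) f p.1 q.1 q.2.
Proof.
by case: bi => -[[_ [e _]]] _ _ _ _ _ Lf; have := e c _ _ Lf; rewrite !sum_sbind2.
Qed.

Lemma rr_coassoc (f : C -> H -> H -> U) c : trilin f ->
  \sum_(p <- rr c) \sum_(q <- rr p.1) f q.1 q.2 p.2 =
  \sum_(p <- rr c) \sum_(d <- cop hH p.2) f p.1 d.1 d.2.
Proof.
by case: bi => -[_ [_ [e _]]] _ _ _ _ Lf; have := e c _ _ Lf; rewrite !sum_sbind2.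
Qed.

Lemma rl_rr (f : H -> C -> H -> U) c : trilin f ->
  \sum_(p <- rl c) \sum_(q <- rr p.2) f p.1 q.1 q.2 =
  \sum_(q <- rr c) \sum_(p <- rl q.1) f p.1 p.2 q.2.
Proof.
by case: bi => _ e _ _ _ Lf; have := e c _ _ Lf; rewrite !sum_sbind2.
Qed.

Lemma rl_mul (f : H -> C -> U) a b : bilin f ->
  \sum_(p <- rl (a * b)) f p.1 p.2 =
  \sum_(p <- rl a) \sum_(q <- rl b) f (p.1 * q.1) (p.2 * q.2).
Proof.
by case: bi => _ _ [e _] _ _ Lf; have := e a b _ _ Lf; rewrite !sum_sbind2.
Qed.

Lemma rr_mul (f : C -> H -> U) a b : bilin f ->
  \sum_(p <- rr (a * b)) f p.1 p.2 =
  \sum_(p <- rr a) \sum_(q <- rr b) f (p.1 * q.1) (p.2 * q.2).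
Proof.
by case: bi => _ _ [_ [_ [e _]]] _ _ Lf; have := e a b _ _ Lf; rewrite !sum_sbind2.
Qed.

Lemma rl_one (f : H -> C -> U) : bilin f -> \sum_(p <- rl 1) f p.1 p.2 = f 1 1.
Proof. by case: bi => _ _ [_ [e _]] _ _ Lf; rewrite (e _ _ Lf) big_seq1. Qed.

Lemma rr_one (f : C -> H -> U) : bilin f -> \sum_(p <- rr 1) f p.1 p.2 = f 1 1.
Proof. by case: bi => _ _ [_ [_ [_ e]]] _ _ Lf; rewrite (e _ _ Lf) big_seq1. Qed.

Lemma rl_cop (f : H -> C -> C -> U) c : trilin f ->
  \sum_(p <- rl c) \sum_(d <- cop hC p.2) f p.1 d.1 d.2 =
  \sum_(d <- cop hC c) \sum_(q <- rl d.1) \sum_(r <- rl d.2)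
    f (q.1 * r.1) q.2 r.2.
Proof.
case: bi => _ _ _ [e _] _ Lf; have := e c _ _ Lf; rewrite sum_sbind2 => ->.
by rewrite sum_sbind; apply: eq_bigr => d _; rewrite sum_sbind2.
Qed.

Lemma rr_cop (f : C -> C -> H -> U) c : trilin f ->
  \sum_(p <- rr c) \sum_(d <- cop hC p.1) f d.1 d.2 p.2 =
  \sum_(d <- cop hC c) \sum_(q <- rr d.1) \sum_(r <- rr d.2)
    f q.1 r.1 (q.2 * r.2).
Proof.
case: bi => _ _ _ [_ e] _ Lf; have := e c _ _ Lf; rewrite sum_sbind2 => ->.
by rewrite sum_sbind; apply: eq_bigr => d _; rewrite sum_sbind2.
Qed.

End Multilinear.

(** * The two commuting actions on points by group automorphisms *)

Section Actions.
Variable K : comAlgType k.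
Implicit Types (n m : pt aC K) (g h : pt aH K).

Lemma amap_la g n : amap (fun c => \sum_(p <- rl c) g p.1 * n p.2).
Proof.
have Lgn := bilin_mul (pt_lin g) (pt_lin n).
split; first exact: lin2_sum rl_lin Lgn.
  move=> x y; rewrite (rl_mul _ _ Lgn) mulr_suml.
  apply: eq_bigr => p _; rewrite mulr_sumr; apply: eq_bigr => q _.
  by rewrite !pt_mul mulrACA.
by rewrite (rl_one Lgn) !pt_one mulr1.
Qed.

Lemma amap_ra n g : amap (fun c => \sum_(p <- rr c) n p.1 * g p.2).
Proof.
have Lng := bilin_mul (pt_lin n) (pt_lin g).
split; first exact: lin2_sum rr_lin Lng.
  move=> x y; rewrite (rr_mul _ _ Lng) mulr_suml.
  apply: eq_bigr => p _; rewrite mulr_sumr; apply: eq_bigr => q _.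
  by rewrite !pt_mul mulrACA.
by rewrite (rr_one Lng) !pt_one mulr1.
Qed.

Definition la g n : pt aC K := Pt aC (amap_la g n).
Definition ra n g : pt aC K := Pt aC (amap_ra n g).

Lemma laE g n c : la g n c = \sum_(p <- rl c) g p.1 * n p.2.
Proof. by []. Qed.

Lemma raE n g c : ra n g c = \sum_(p <- rr c) n p.1 * g p.2.
Proof. by []. Qed.

Lemma la1 n : la 1%g n = n.
Proof.
apply: pt_eq => c; rewrite laE -[in RHS](rl_counit c) (lin_sum (pt_lin n)).
by apply: eq_bigr => p _; rewrite (linZ (pt_lin n)) pt1E -scalerAl mul1r.
Qed.

Lemma ra1 n : ra n 1%g = n.
Proof.
apply: pt_eq => c; rewrite raE -[in RHS](rr_counit c) (lin_sum (pt_lin n)).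
by apply: eq_bigr => p _; rewrite (linZ (pt_lin n)) pt1E -scalerAr mulr1.
Qed.

Lemma laM g h n : la (g * h)%g n = la g (la h n).
Proof.
apply: pt_eq => c; rewrite !laE.
transitivity (\sum_(p <- rl c) \sum_(d <- cop hH p.1) g d.1 * h d.2 * n p.2).
  by apply: eq_bigr => p _; rewrite ptME mulr_suml.
rewrite (rl_coassoc _ (trilin_mul (pt_lin g) (pt_lin h) (pt_lin n))).
apply: eq_bigr => p _; rewrite laE mulr_sumr.
by apply: eq_bigr => q _; rewrite mulrA.
Qed.

Lemma raM n g h : ra n (g * h)%g = ra (ra n g) h.
Proof.
apply: pt_eq => c; rewrite !raE; symmetry.
transitivity (\sum_(p <- rr c) \sum_(q <- rr p.1) n q.1 * g q.2 * h p.2).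
  by apply: eq_bigr => p _; rewrite raE mulr_suml.
rewrite (rr_coassoc _ (trilin_mul (pt_lin n) (pt_lin g) (pt_lin h))).
apply: eq_bigr => p _; rewrite ptME mulr_sumr.
by apply: eq_bigr => q _; rewrite mulrA.
Qed.

Lemma lara g n h : la g (ra n h) = ra (la g n) h.
Proof.
apply: pt_eq => c; rewrite laE raE.
transitivity (\sum_(p <- rl c) \sum_(q <- rr p.2) g p.1 * n q.1 * h q.2).
  apply: eq_bigr => p _; rewrite raE mulr_sumr.
  by apply: eq_bigr => q _; rewrite mulrA.
rewrite (rl_rr _ (trilin_mul (pt_lin g) (pt_lin n) (pt_lin h))).
by apply: eq_bigr => p _; rewrite laE mulr_suml.
Qed.

Lemma laD g n m : la g (n * m)%g = (la g n * la g m)%g.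
Proof.
apply: pt_eq => c; rewrite laE ptME.
transitivity (\sum_(p <- rl c) \sum_(d <- cop hC p.2) g p.1 * n d.1 * m d.2).
  apply: eq_bigr => p _; rewrite ptME mulr_sumr.
  by apply: eq_bigr => q _; rewrite mulrA.
rewrite (rl_cop _ (trilin_mul (pt_lin g) (pt_lin n) (pt_lin m))).
apply: eq_bigr => d _; rewrite laE mulr_suml; apply: eq_bigr => q _.
rewrite laE mulr_sumr; apply: eq_bigr => r _; rewrite pt_mul; ring.
Qed.

Lemma raD n m g : ra (n * m)%g g = (ra n g * ra m g)%g.
Proof.
apply: pt_eq => c; rewrite raE ptME.
transitivity (\sum_(p <- rr c) \sum_(d <- cop hC p.1) n d.1 * m d.2 * g p.2).
  by apply: eq_bigr => p _; rewrite ptME mulr_suml.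
rewrite (rr_cop _ (trilin_mul (pt_lin n) (pt_lin m) (pt_lin g))).
apply: eq_bigr => d _; rewrite raE mulr_suml; apply: eq_bigr => q _.
rewrite raE mulr_sumr; apply: eq_bigr => r _; rewrite pt_mul; ring.
Qed.

End Actions.

(** * Evaluation of the structure maps and of both compatibilities at points *)

Section Evaluation.
Variable K : comAlgType k.
Local Notation N := (pt aC K).
Local Notation G := (pt aH K).
Implicit Types (z : C * H) (s t : seq (C * H)).

Definition ev (x : N * G) z : K := x.1 z.1 * x.2 z.2.

(** The shape shared by [Btilde] and [sm_antip]: one point [g] is evaluated on both coaction
    components and on the element of [H], so it acts on [n] from both sides. *)
Lemma ev_twist (n : N) (g : G) z :
  \sum_(p <- rl z.1) \sum_(q <- rr p.2) n q.1 * g (p.1 * q.2 * z.2) =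
  ev (ra (la g n) g, g) z.
Proof.
rewrite -lara /ev /= mulr_suml; apply: eq_bigr => p _.
rewrite mulr_sumr mulr_suml; apply: eq_bigr => q _.
by rewrite !pt_mul; ring.
Qed.

Lemma ev_cop (x y : N * G) z : \sum_(p <- sm_cop hC hH rl rr z) ev x p.1 * ev y p.2 =
  ev (sdp_mul (@la K) (@ra K) x y) z.
Proof.
rewrite /ev /sdp_mul /= sum_sbind mulr_suml; apply: eq_bigr => p _.
rewrite sum_sbind !mulr_suml; apply: eq_bigr => a _.
rewrite sum_sbind [_ * \sum_(_ <- rl _) _]mulr_sumr mulr_suml.
apply: eq_bigr => b _.
rewrite sum_sbind mulr_sumr; apply: eq_bigr => d _.
by rewrite big_seq1 !pt_mul; ring.
Qed.

Lemma ev_antip (x : N * G) z : \sum_(p <- sm_antip hC hH rl rr z) ev x p =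
  ev (sdp_inv (@la K) (@ra K) x) z.
Proof. by rewrite sum_sbind2 -ev_twist. Qed.

Lemma ev_mul (x : N * G) s t : \sum_(p <- sm_mul s t) ev x p =
  (\sum_(p <- s) ev x p) * (\sum_(p <- t) ev x p).
Proof.
rewrite (sum_sm_mul s t (fun a b => x.1 a * x.2 b)) mulr_suml.
apply: eq_bigr => p _; rewrite mulr_sumr; apply: eq_bigr => q _.
by rewrite !pt_mul mulrACA.
Qed.

Lemma ev_cop3 (x y u v : N * G) s :
  \sum_(p <- sm_cop3 hC hH rl rr s)
    ev x p.1.1.1 * ev y p.1.1.2 * ev u p.1.2 * ev v p.2 =
  \sum_(z <- s)
    ev (sdp_mul (@la K) (@ra K) (sdp_mul (@la K) (@ra K)
         (sdp_mul (@la K) (@ra K) x y) u) v) z.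
Proof.
rewrite sum_sbind; apply: eq_bigr => z _; rewrite -ev_cop.
rewrite sum_sbind; apply: eq_bigr => p _; rewrite -ev_cop mulr_suml.
rewrite sum_sbind; apply: eq_bigr => q _; rewrite -ev_cop !mulr_suml.
by rewrite sum_sbind; apply: eq_bigr => r _; rewrite big_seq1.
Qed.

(** Pure tensors with one entry equal to [1] isolate the two coordinates. *)
Lemma ev_inj (x y : N * G) : (forall z, ev x z = ev y z) -> x = y.
Proof.
case: x y => [n g] [m h] e; congr pair; apply: pt_eq => c.
  by have := e (c, 1); rewrite /ev /= !pt_one !mulr1.
by have := e (1, c); rewrite /ev /= !pt_one !mul1r.
Qed.

Variables (R : C -> C) (B : H -> H) (HR : amap R) (HB : amap B).
Local Notation r := (@pt_pre _ _ _ aC K R HR).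
Local Notation b := (@pt_pre _ _ _ aH K B HB).
Local Notation bt := (btilde (@la K) (@ra K) r b).

Lemma ev_btilde (x : N * G) z : \sum_(p <- Btilde rl rr R B z) ev x p = ev (bt x) z.
Proof. by rewrite sum_sbind2 -ev_twist. Qed.

Lemma ev_ext (x : N * G) s :
  \sum_(p <- ext (Btilde rl rr R B) s) ev x p = \sum_(z <- s) ev (bt x) z.
Proof. by rewrite sum_sbind; apply: eq_bigr => z _; rewrite ev_btilde. Qed.

Let T := Btilde rl rr R B.

Lemma ev_rb_lhs (x y : N * G) s :
  \sum_(p <- sbind (sbind s (sm_cop hC hH rl rr)) (fun uv => sbind (T uv.1)
      (fun a => sbind (T uv.2) (fun b => [:: (a.1, a.2, b.1, b.2)]))))
    x.1 p.1.1.1 * x.2 p.1.1.2 * (y.1 p.1.2 * y.2 p.2) =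
  \sum_(z <- s) ev (sdp_mul (@la K) (@ra K) (bt x) (bt y)) z.
Proof.
rewrite !sum_sbind; apply: eq_bigr => z _; rewrite -ev_cop.
apply: eq_bigr => p _; rewrite sum_sbind2 -!ev_btilde mulr_suml.
by apply: eq_bigr => a _; rewrite mulr_sumr.
Qed.

(** Pulling [x] back along [Btilde] gives the point [bt x], so the product of the second leg with
    the antipode of the fourth yields [bt x] on the second leg and its inverse on the fourth. *)
Lemma ev_rb_rhs (x y : N * G) s :
  \sum_(p <- sbind (sm_cop3 hC hH rl rr (ext T s)) (fun w =>
      sbind (ext T (sm_mul [:: w.1.1.2] (sm_antip hC hH rl rr w.2))) (fun z =>
        [:: (w.1.1.1.1 * z.1, w.1.1.1.2 * z.2, w.1.2.1, w.1.2.2)])))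
    x.1 p.1.1.1 * x.2 p.1.1.2 * (y.1 p.1.2 * y.2 p.2) =
  \sum_(z <- s) ev (bt (sdp_mul (@la K) (@ra K) (sdp_mul (@la K) (@ra K)
    (sdp_mul (@la K) (@ra K) x (bt x)) y) (sdp_inv (@la K) (@ra K) (bt x)))) z.
Proof.
rewrite -ev_ext -ev_cop3 sum_sbind; apply: eq_bigr => w _.
transitivity (ev x w.1.1.1 * (\sum_(z <- ext T (sm_mul [:: w.1.1.2]
    (sm_antip hC hH rl rr w.2))) ev x z) * ev y w.1.2).
  rewrite sum_sbind mulr_sumr mulr_suml; apply: eq_bigr => z _.
  by rewrite big_seq1 /ev !pt_mul /=; ring.
by rewrite ev_ext ev_mul big_seq1 ev_antip; ring.
Qed.

(** The last slot is the product [a.2 * e.1] of two coaction components, so the same [g] acts on the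
    first leg from the right and on the third from the left; the antipode on the third leg gives the
    inverse of [r n]. *)
Lemma compat1_eval (n m : N) (g : G) c :
  \sum_(p <- sbind (cop2 hC (R c)) (fun y => sbind (rr y.1.1) (fun a =>
       sbind (cop hC a.1) (fun d => sbind (rl y.2) (fun e =>
         [:: (d.1 * R (d.2 * antip hC e.2), y.1.2, a.2 * e.1)])))))
     n p.1.1 * m p.1.2 * g p.2 =
  r (ra (n * r n) g * m * la g (r n)^-1)%g c.
Proof.
have [_ MR _] := HR.
rewrite pt_preE ptME sum_sbind sum_sbind; apply: eq_bigr => p _.
rewrite ptME mulr_suml sum_sbind; apply: eq_bigr => q _.
rewrite big_seq1 raE sum_sbind !mulr_suml; apply: eq_bigr => a _.
rewrite ptME !mulr_suml sum_sbind; apply: eq_bigr => d _.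
rewrite laE mulr_sumr sum_sbind; apply: eq_bigr => e _.
by rewrite big_seq1 /= MR !pt_mul; ring.
Qed.

Lemma compat1_eval_rhs (n m : N) (g : G) c :
  \sum_(p <- sbind (cop hC c) (fun p => sbind (rl p.1) (fun q =>
       [:: (R q.2, R p.2, B (antip hH q.1))]))) n p.1.1 * m p.1.2 * g p.2 =
  (la (b g)^-1 (r n) * r m)%g c.
Proof.
rewrite sum_sbind2 ptME; apply: eq_bigr => p _.
by rewrite mulr_suml; apply: eq_bigr => q _; rewrite ptVE /=; ring.
Qed.

(** The slot in [H] splits under [g] into [g] on [d.1], [b g] on [d.2] and the inverse of [b g] on
    [a.2]: the first two make up the left action, the last one the right action. *)
Lemma compat2_eval (m : N) (g : G) c :
  \sum_(p <- sbind (rr (R c)) (fun a => sbind (rl a.1) (fun b =>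
       sbind (cop hH b.1) (fun d => [:: (d.1 * B (d.2 * antip hH a.2), b.2)]))))
     g p.1 * m p.2 =
  r (ra (la (g * b g) m) (b g)^-1)%g c.
Proof.
have [_ MB _] := HB.
rewrite pt_preE raE sum_sbind; apply: eq_bigr => a _.
rewrite laE mulr_suml sum_sbind; apply: eq_bigr => q _.
rewrite ptME !mulr_suml sum_sbind; apply: eq_bigr => d _.
by rewrite big_seq1 ptVE /= MB !pt_mul; ring.
Qed.

Lemma compat2_eval_rhs (m : N) (g : G) c :
  \sum_(p <- sbind (rr c) (fun a => [:: (B (antip hH a.2), R a.1)]))
     g p.1 * m p.2 = ra (r m) (b g)^-1%g c.
Proof.
rewrite sum_sbind; apply: eq_bigr => a _.
by rewrite big_seq1 ptVE mulrC.
Qed.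

End Evaluation.

(** * Translation of the conditions on tensors into conditions on points *)

Section Equivalences.
Variables (R : C -> C) (B : H -> H) (HR : amap R) (HB : amap B).
Let r (K : comAlgType k) := @pt_pre _ _ _ aC K R HR.
Let b (K : comAlgType k) := @pt_pre _ _ _ aH K B HB.
Let T := Btilde rl rr R B.

Lemma smash_coop_points :
  (forall s : seq (C * H), teq4
    (sbind (sbind s (sm_cop hC hH rl rr)) (fun uv => sbind (T uv.1) (fun a =>
       sbind (T uv.2) (fun b => [:: (a.1, a.2, b.1, b.2)]))))
    (sbind (sm_cop3 hC hH rl rr (ext T s)) (fun y =>
       sbind (ext T (sm_mul [:: y.1.1.2] (sm_antip hC hH rl rr y.2))) (fun z =>
         [:: (y.1.1.1.1 * z.1, y.1.1.1.2 * z.2, y.1.2.1, y.1.2.2)])))) <->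
  (forall K, sdp_rb (@la K) (@ra K) (@r K) (@b K)).
Proof.
split => [e K x y|e s].
  apply: ev_inj => z; have := e [:: z] _ _ (quadlin_mul (pt_lin x.1)
    (pt_lin x.2) (pt_lin y.1) (pt_lin y.2)).
  by rewrite (ev_rb_lhs HR HB) (ev_rb_rhs HR HB) !big_seq1.
apply: (@teq4_points _ (hopf_aug aC) (hopf_aug aH) (hopf_aug aC) (hopf_aug aH)).
move=> K n g m l Hn Hg Hm Hl.
(* Algebra maps on the four factors [C], [H], [C], [H] are the same data as two points of the smash
   coproduct. *)
pose x : pt aC K * pt aH K := (Pt aC Hn, Pt aH Hg).
pose y : pt aC K * pt aH K := (Pt aC Hm, Pt aH Hl).
by rewrite (ev_rb_lhs HR HB x y) (ev_rb_rhs HR HB x y) e.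
Qed.

Lemma compat1_points : (forall c, compat1 hC hH rl rr R B c) <->
  (forall K, point_compat1 (@la K) (@ra K) (@r K) (@b K)).
Proof.
split => [e K n m g|e c].
  apply: pt_eq => c; have := e c _ _ (trilin_mul (pt_lin n) (pt_lin m) (pt_lin g)).
  by rewrite (compat1_eval HR) (compat1_eval_rhs HR HB).
apply: (@teq3_points _ (hopf_aug aC) (hopf_aug aC) (hopf_aug aH)).
move=> K n m g Hn Hm Hg.
rewrite (compat1_eval HR (Pt aC Hn) (Pt aC Hm) (Pt aH Hg)).
rewrite (compat1_eval_rhs HR HB (Pt aC Hn) (Pt aC Hm) (Pt aH Hg)).
by have /(congr1 (fun f : pt aC K => f c)) := e K (Pt aC Hn) (Pt aC Hm) (Pt aH Hg).
Qed.

Lemma compat2_points : (forall c, compat2 hH rl rr R B c) <->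
  (forall K, point_compat2 (@la K) (@ra K) (@r K) (@b K)).
Proof.
split => [e K m g|e c].
  apply: pt_eq => c; have := e c _ _ (bilin_mul (pt_lin g) (pt_lin m)).
  by rewrite (compat2_eval HR HB) (compat2_eval_rhs HR HB).
apply: (@teq2_points _ (hopf_aug aH) (hopf_aug aC)) => K g m Hg Hm.
rewrite (compat2_eval HR HB (Pt aC Hm) (Pt aH Hg)).
rewrite (compat2_eval_rhs HR HB (Pt aC Hm) (Pt aH Hg)).
by have /(congr1 (fun f : pt aC K => f c)) := e K (Pt aC Hm) (Pt aH Hg).
Qed.

(** At a point [x], applying [Btilde] amounts to evaluating at [bt x], which is again a pair of
    algebra maps and hence multiplicative. *)
Lemma Btilde_mul s t :
  teq2 (ext T (sm_mul s t)) (sm_mul (ext T s) (ext T t)).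
Proof.
apply: (@teq2_points _ (hopf_aug aC) (hopf_aug aH)) => K n g Hn Hg.
pose x : pt aC K * pt aH K := (Pt aC Hn, Pt aH Hg).
rewrite [LHS](ev_ext HR HB x) [RHS](ev_mul x).
by rewrite !(ev_ext HR HB) ev_mul.
Qed.

Lemma Btilde_one : teq2 (T (1, 1)) [:: (1, 1)].
Proof.
apply: (@teq2_points _ (hopf_aug aC) (hopf_aug aH)) => K n g Hn Hg.
pose x : pt aC K * pt aH K := (Pt aC Hn, Pt aH Hg).
rewrite [LHS](ev_btilde HR HB x) big_seq1 /ev !pt_one.
by have [[_ _ ->] [_ _ ->]] := (Hn, Hg).
Qed.

Hypothesis RB_B : rota_baxter_coop hH B.

(** With [R] and [B] algebra maps, so is [Btilde]; the remaining identities become families indexed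
    by [K], and [sdp_rb_iff] applies for each [K]. *)
Lemma smash_rota_baxter_iff : smash_rota_baxter_coop hC hH rl rr T <->
  [/\ rota_baxter_coop hC R, (forall c, compat1 hC hH rl rr R B c) &
      (forall c, compat2 hH rl rr R B c)].
Proof.
have sdpE (K : comAlgType k) := sdp_rb_iff (@la1 K) (@ra1 K) (@laM K) (@raM K) (@lara K)
  (@laD K) (@raD K) (@r K) ((rota_baxter_points aH HB).1 RB_B K).
split => [[_ _ /smash_coop_points e]|].
  split; [apply/(rota_baxter_points aC HR)|apply/compat1_points|
    apply/compat2_points] => K; by case/sdpE: (e K).
case=> /(rota_baxter_points aC HR) hr /compat1_points h1 /compat2_points h2.
split; [exact: Btilde_mul|exact: Btilde_one|].
by apply/smash_coop_points => K; apply/sdpE; split.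
Qed.

End Equivalences.

(** * Recovering that [R] is an algebra map *)

Section Counit.
Variables (R : C -> C) (B : H -> H).
Hypotheses (LR : lin R) (RB_B : rota_baxter_coop hH B).

(** The unit of the point group is the counit, and [rb_op1] says that precomposition with [B] fixes
    it. Taking [K = H] lets [cou hH] be applied to the resulting multiples of [1]. *)
Lemma cou_rota_baxter x : cou hH (B x) = cou hH x.
Proof.
have HB : amap B by case: RB_B.
have := congr1 (fun f : pt aH H => cou hH (f x))
  (rb_op1 ((rota_baxter_points aH HB).1 RB_B H)).
by rewrite pt_preE !pt1E !(linZ (cou_lin aH)) (cou_one aH) /GRing.scale /= !mulr1.
Qed.

(** As the counit absorbs [B] and is multiplicative, it falls on each coaction component separately,
    and the counit axioms collapse both coactions. *)
Lemma Btilde_counit z :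
  \sum_(p <- Btilde rl rr R B z) cou hH p.2 *: p.1 = cou hH z.2 *: R z.1.
Proof.
rewrite sum_sbind2 -[in RHS](rl_counit z.1) (lin_sum LR) scaler_sumr.
apply: eq_bigr => p _; rewrite (linZ LR) -[in RHS](rr_counit p.2).
rewrite (lin_sum LR) !scaler_sumr; apply: eq_bigr => q _.
rewrite (linZ LR) cou_rota_baxter !(cou_mul aH) !scalerA; congr (_ *: _).
ring.
Qed.

(* [id (x) counit] is an algebra map carrying [Btilde] to [R]. *)
Lemma amap_of_Btilde : smash_rota_baxter_coop hC hH rl rr (Btilde rl rr R B) ->
  amap R.
Proof.
move=> [M one _].
have Lf : bilin (fun (c : C) (h : H) => cou hH h *: c).
  split => [h|c] a u v; first by rewrite scalerDr !scalerA mulrC.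
  by rewrite (cou_lin aH) scalerDl scalerA.
split=> // [u v|].
  have extE z : ext (Btilde rl rr R B) [:: z] = Btilde rl rr R B z.
    exact: cats0.
  have := M [:: (u, 1)] [:: (v, 1)] _ _ Lf.
  rewrite (_ : sm_mul [:: (u, 1)] _ = [:: (u * v, 1 * 1)]) // !extE.
  rewrite Btilde_counit (sum_sm_mul _ _ (fun c h => cou hH h *: c)) /=.
  rewrite mulr1 (cou_one aH) scale1r => ->.
  have cou1 w : R w = \sum_(p <- Btilde rl rr R B (w, 1)) cou hH p.2 *: p.1.
    by rewrite Btilde_counit /= (cou_one aH) scale1r.
  rewrite !cou1 mulr_suml; apply: eq_bigr => p _.
  rewrite mulr_sumr; apply: eq_bigr => q _.
  by rewrite (cou_mul aH) -scalerAr -scalerAl scalerA mulrC.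
have := one _ _ Lf.
by rewrite Btilde_counit big_seq1 /= (cou_one aH) !scale1r.
Qed.

End Counit.

End Smash.

Theorem theorem3p3 (k : fieldType) (C H : comAlgType k)
    (hC : hopf_ops C) (hH : hopf_ops H)
    (rl : C -> seq (H * C)) (rr : C -> seq (C * H))
    (R : C -> C) (B : H -> H) :
  hopf_algebra hC -> hopf_algebra hH ->
  bicomodule_hopf hC hH rl rr ->
  lin R ->
  rota_baxter_coop hH B ->
  (smash_rota_baxter_coop hC hH rl rr (Btilde rl rr R B) <->
   [/\ rota_baxter_coop hC R,
       (forall c : C, compat1 hC hH rl rr R B c) &
       (forall c : C, compat2 hH rl rr R B c)]).
Proof.
move=> aC aH bi LR RB; have HB : amap B by case: RB.
have main (HR : amap R) := smash_rota_baxter_iff aC aH bi HR HB RB.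
(* [main] presupposes that [R] is an algebra map: from left to right this is drawn from [Btilde],
   from right to left it is part of the Rota-Baxter condition on [R]. *)
split => h; first exact: (main (amap_of_Btilde aH bi LR RB h)).1 h.
have HR : amap R by case: h => -[].
exact: (main HR).2 h.
Qed.
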